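(* Let $\varphi\in L^2(\mathbb{R}^2)$ satisfy $\operatorname{supp}(\varphi)\subseteq[N_1,M_1]\times[N_2,M_2]$, and suppose that $\{\varphi(\cdot-\boldsymbol{k}):\boldsymbol{k}\in\mathbb{Z}^2\}$ is linearly independent in $L^2(\mathbb{R}^2)$. Let $\boldsymbol{p}=(\cos\theta,\sin\theta)$ be a direction vector, let $[a_1,b_1]\times[a_2,b_2]$ be a rectangle, and put $$E=\big([\lceil a_1-M_1\rceil,\lfloor b_1-N_1\rfloor]\times[\lceil a_2-M_2\rceil,\lfloor b_2-N_2\rfloor]\big)\cap\mathbb{Z}^2 .$$ Then any $f\in V(\varphi,\mathbb{Z}^2)$ with $\operatorname{supp}(f)\subseteq[a_1,b_1]\times[a_2,b_2]$ can be determined uniquely by its single-angle Radon transform $\mathcal{R}_{\boldsymbol{p}}f$ if and only if the (indexed) system $\{\mathcal{R}_{\boldsymbol{p}}\varphi(\cdot-\boldsymbol{p}\boldsymbol{k}):\boldsymbol{k}\in E\}$ is linearly independent in $L^2(\mathbb{R})$.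
   Context: Vectors in $\mathbb{R}^2$ are columns; the direction vector $\boldsymbol{p}=(\cos\theta,\sin\theta)$ is a row vector, so $\boldsymbol{p}\boldsymbol{k}=k_1\cos\theta+k_2\sin\theta\in\mathbb{R}$ for $\boldsymbol{k}=(k_1,k_2)^T$. The Radon transform at the single angle $\theta$ is $\mathcal{R}_{\boldsymbol{p}}f(t)=\int_{-\infty}^{\infty}f(t\cos\theta-s\sin\theta,\,t\sin\theta+s\cos\theta)\,ds$; for compactly supported $f\in L^2(\mathbb{R}^2)$ it belongs to $L^2(\mathbb{R})$. The shift-invariant space is $V(\varphi,\mathbb{Z}^2)=\{\sum_{\boldsymbol{k}\in\mathbb{Z}^2}c_{\boldsymbol{k}}\varphi(\cdot-\boldsymbol{k}):\sum_{\boldsymbol{k}}|c_{\boldsymbol{k}}|^2<\infty\}$. Standing convention: a target function $f\in V(\varphi,\mathbb{Z}^2)$ with $\operatorname{supp}(f)\subseteq[a_1,b_1]\times[a_2,b_2]$ is one expressed as $f=\sum_{\boldsymbol{k}\in E}c_{\boldsymbol{k}}\varphi(\cdot-\boldsymbol{k})$ with $c_{\boldsymbol{k}}\in\mathbb{C}$. ''$f$ can be determined uniquely by $\mathcal{R}_{\boldsymbol{p}}f$'' means that $f$ is the only function of the form $\sum_{\boldsymbol{k}\in E}d_{\boldsymbol{k}}\varphi(\cdot-\boldsymbol{k})$, $d_{\boldsymbol{k}}\in\mathbb{C}$, whose Radon transform $\mathcal{R}_{\boldsymbol{p}}$ equals $\mathcal{R}_{\boldsymbol{p}}f$ in $L^2(\mathbb{R})$.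 *)

(* Defs.v *)
From HB Require Import structures.
From mathcomp Require Import all_boot all_order all_algebra finmap.
From mathcomp Require Import all_classical all_reals all_analysis.
From mathcomp.real_closed Require Import complex.

Set Implicit Arguments.
Unset Strict Implicit.
Unset Printing Implicit Defensive.
Import Order.TTheory GRing.Theory Num.Theory.
Import numFieldNormedType.Exports.
Local Open Scope classical_set_scope.
Local Open Scope ring_scope.

(* Finitely supported sum; only meaningful when A is finite. *)
Definition lincomb (T : Type) (R : realType) (I : choiceType)
    (A : set I) (c : I -> R[i]) (e : I -> T -> R[i]) : T -> R[i] :=
  fun x => \sum_(k \in A) c k * e k x.

(* An element of a complex L^2 space is handled through a representative
   T -> R[i] with measurable real and imaginary parts; equality in L^2 is the
   library's almost-everywhere equality [f = g %[ae mu]].  The measurable sets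
   of R and R * R are the Borel ones, which loses no L^2 class. *)
Section ComplexL2.
Context d (T : measurableType d) (R : realType).
Variable mu : {measure set T -> \bar R}.

Definition cmeasurable (f : T -> R[i]) : Prop :=
  measurable_fun [set: T] (fun x => complex.Re (f x)) /\
  measurable_fun [set: T] (fun x => complex.Im (f x)).

Definition cL2norm (f : T -> R[i]) : \bar R :=
  Lnorm mu 2%:E (fun x => (Normc.normc (f x))%:E).

Definition cL2 (f : T -> R[i]) : Prop :=
  cmeasurable f /\ (cL2norm f < +oo)%E.

Definition cintegral (f : T -> R[i]) : R[i] :=
  Complex (\int[mu]_x complex.Re (f x)) (\int[mu]_x complex.Im (f x)).

(* The family is indexed: two indices k <> l in A with e k = e l make it
   dependent. *)
Definition lin_indep (I : choiceType) (A : set I) (e : I -> T -> R[i]) : Prop :=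
  forall (F : set I) (c : I -> R[i]), finite_set F -> F `<=` A ->
    lincomb F c e = cst 0 %[ae mu] -> forall k, F k -> c k = 0.

End ComplexL2.

Section Plane.
Context (R : realType).

Definition leb1 := @lebesgue_measure R.
Definition leb2 := (leb1 \x leb1)%E.

Definition rect (a1 b1 a2 b2 : R) : set (R * R) := `[a1, b1] `*` `[a2, b2].

(* Essential support: complement of the largest open set on which f vanishes
   almost everywhere. *)
Definition ess_support (f : R * R -> R[i]) : set (R * R) :=
  ~` \bigcup_(U in [set U : set (R * R) | open U /\
                      f = cst 0 %[ae leb2 in U]]) U.

Definition translate (phi : R * R -> R[i]) (k : int * int) : R * R -> R[i] :=
  fun x => phi (x.1 - k.1%:~R, x.2 - k.2%:~R).

Definition direction (theta : R) : R * R := (cos theta, sin theta).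

Definition pair_dir (p : R * R) (k : int * int) : R :=
  k.1%:~R * p.1 + k.2%:~R * p.2.

(* For f in L^2 with compact support the integrand is integrable for almost
   every t; the remaining t form a null set, where the value is irrelevant. *)
Definition radon (p : R * R) (f : R * R -> R[i]) : R -> R[i] :=
  fun t => cintegral leb1 (fun s => f (t * p.1 - s * p.2, t * p.2 + s * p.1)).

(* The infinite sum is the limit in L^2 of the net of its finite partial
   sums. *)
Definition in_V (phi f : R * R -> R[i]) : Prop :=
  cL2 leb2 f /\
  exists c : int * int -> R[i],
    (\esum_(k in [set: int * int]) (Normc.normc (c k) ^+ 2)%:E < +oo)%E /\
    forall eps : R, 0 < eps ->
      exists F0 : {fset int * int}, forall F : {fset int * int},
        (F0 `<=` F)%fset ->
        (cL2norm leb2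
          (fun x => (f x - lincomb [set` F] c (translate phi) x)%R) < eps%:E)%E.

Definition index_set (N1 M1 N2 M2 a1 b1 a2 b2 : R) : set (int * int) :=
  [set k | Num.ceil (a1 - M1) <= k.1 <= Num.floor (b1 - N1) /\
           Num.ceil (a2 - M2) <= k.2 <= Num.floor (b2 - N2)].

Definition in_span (phi : R * R -> R[i]) (E : set (int * int))
    (f : R * R -> R[i]) : Prop :=
  cL2 leb2 f /\
  exists c : int * int -> R[i], f = lincomb E c (translate phi) %[ae leb2].

Definition determined_by_radon (p : R * R) (phi : R * R -> R[i])
    (E : set (int * int)) (f : R * R -> R[i]) : Prop :=
  forall g : R * R -> R[i], in_span phi E g ->
    radon p g = radon p f %[ae leb1] -> g = f %[ae leb2].

End Plane.

(* Main.v *)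
(* A plane rotation preserves Lebesgue measure: it is the half turn or a product
   of three shears, and by Tonelli a shear inherits the translation invariance
   of Lebesgue measure on its fibres.  Hence the Radon transform respects
   almost-everywhere equality and, by Fubini, is almost everywhere linear on
   L^1, which contains the compactly supported L^2 functions.  Moreover
   R_p(phi(. - k)) = R_p phi(. - pk), so on the span of the translates R_p is
   the linear map that sends (c_k) to sum_k c_k R_p phi(. - pk); unique
   determination is the injectivity of this map, and necessity follows from the
   case f = 0. *)
Require Import Defs.
From mathcomp Require Import all_boot all_order all_algebra finmap.
From mathcomp Require Import all_classical all_reals all_analysis.
From mathcomp Require Import measurable_realfun ring lra zify.
From mathcomp.real_closed Require Import complex.

Set Implicit Arguments.
Unset Strict Implicit.
Unset Printing Implicit Defensive.
Import Order.TTheory GRing.Theory Num.Theory.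
Import numFieldNormedType.Exports.
Local Open Scope classical_set_scope.
Local Open Scope ring_scope.

(** * Measure-preserving maps and change of variables *)

Section MeasurePreserving.
Context d (T : measurableType d) (R : realType).
Variable mu : {measure set T -> \bar R}.
Local Open Scope ereal_scope.

Definition measure_preserving (phi : T -> T) : Prop :=
  measurable_fun [set: T] phi /\
  forall A, measurable A -> mu (phi @^-1` A) = mu A.

Lemma measure_preserving_comp (phi psi : T -> T) :
  measure_preserving phi -> measure_preserving psi ->
  measure_preserving (phi \o psi).
Proof.
move=> [mphi phiE] [mpsi psiE]; split=> [|A mA]; first exact: measurableT_comp.
rewrite comp_preimage psiE ?phiE//.
by rewrite -[X in measurable X]setTI; exact: mphi.
Qed.

(** For nonnegative functions this is integration against the pushforward measure, which agrees with
    [mu] on measurable sets. The general case applies this to the positive and negative parts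
    separately. *)
Lemma integral_measure_preserving (phi : T -> T) (f : T -> \bar R) :
  measure_preserving phi -> measurable_fun [set: T] f ->
  \int[mu]_x f (phi x) = \int[mu]_x f x.
Proof.
move=> [mphi phiE] mf.
have ge0E (g : T -> \bar R) : measurable_fun [set: T] g ->
    (forall x, 0 <= g x) -> \int[mu]_x g (phi x) = \int[mu]_x g x.
  move=> mg g0.
  have := @ge0_integral_pushforward _ _ _ _ _ _ mphi mu setT g measurableT mg.
  rewrite preimage_setT => <-; last by move=> y _; exact: g0.
  by apply: eq_measure_integral => A mA _; exact: phiE.
rewrite -[LHS]/(\int[mu]_x (f \o phi) x) [LHS]integralE [RHS]integralE.
rewrite funepos_comp funeneg_comp; congr (_ - _); apply: ge0E => //.
  exact: measurable_funepos.
exact: measurable_funeneg.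
Qed.

Lemma integrable_measure_preserving (phi : T -> T) (f : T -> \bar R) :
  measure_preserving phi -> mu.-integrable [set: T] f ->
  mu.-integrable [set: T] (f \o phi).
Proof.
move=> phiP /integrableP[mf foo]; apply/integrableP; split.
  by apply: measurableT_comp => //; case: phiP.
rewrite (@integral_measure_preserving phi (fun x => `|f x|) phiP)//.
exact: measurableT_comp.
Qed.

Lemma ae_measure_preserving (phi : T -> T) (P : set T) :
  measure_preserving phi -> (\forall x \ae mu, P x) ->
  \forall x \ae mu, P (phi x).
Proof.
move=> [mphi phiE] [N [mN N0 PN]]; exists (phi @^-1` N); split.
- by rewrite -[X in measurable X]setTI; exact: mphi.
- by rewrite phiE.
- by move=> x Px; exact: PN.
Qed.

End MeasurePreserving.
Arguments measure_preserving {d T R}.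

(** * Product measures: fibres of null sets and fibrewise invariance *)

Section Fibres.
Context d1 d2 (T1 : measurableType d1) (T2 : measurableType d2) (R : realType).
Variables (m1 : {sigma_finite_measure set T1 -> \bar R})
  (m2 : {sigma_finite_measure set T2 -> \bar R}).
Local Open Scope ereal_scope.

(** The product measure of a null set is the integral of the measures of its sections; a nonnegative
    function with zero integral vanishes almost everywhere. *)
Lemma ae_prod_fst (P : set (T1 * T2)) : (\forall z \ae (m1 \x m2), P z) ->
  \forall x \ae m1, \forall y \ae m2, P (x, y).
Proof.
move=> [N [mN N0 PN]].
have mxN : measurable_fun setT (fun x => m2 (xsection N x)).
  exact: measurable_fun_xsection.
have : ae_eq m1 setT (fun x => m2 (xsection N x)) (cst 0).
  apply/ae_eq_integral_abs => //.
  by under eq_integral do rewrite gee0_abs//.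
apply: filterS => x /(_ I) xN0; exists (xsection N x); split => //.
  exact: measurable_xsection.
by move=> y Pxy; rewrite /xsection/= inE; exact: PN.
Qed.

(** The section at [x] of the preimage of [A] is the preimage under [phi x] of the section of [A],
    so the integrands that define the two product measures coincide. *)
Lemma measure_preserving_snd (phi : T1 -> T2 -> T2) :
  measurable_fun [set: T1 * T2] (fun z => phi z.1 z.2) ->
  (forall x, measure_preserving m2 (phi x)) ->
  measure_preserving (m1 \x m2) (fun z => (z.1, phi z.1 z.2)).
Proof.
move=> mphi phiP; split=> [|A mA].
  exact: measurable_fun_pair.
apply: eq_integral => x _ /=; rewrite -[RHS](phiP x).2; last first.
  exact: measurable_xsection.
by congr (m2 _); apply/seteqP; split=> y; rewrite /xsection/= !inE.
Qed.

(** Since [\x] integrates over [x]-sections, the argument first passes to [\x^], which integrates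
    over [y]-sections; both agree by uniqueness from their values on measurable rectangles. *)
Lemma measure_preserving_fst (phi : T2 -> T1 -> T1) :
  measurable_fun [set: T1 * T2] (fun z => phi z.2 z.1) ->
  (forall y, measure_preserving m1 (phi y)) ->
  measure_preserving (m1 \x m2) (fun z => (phi z.2 z.1, z.2)).
Proof.
move=> mphi phiP.
have m12E A : measurable A -> (m1 \x m2) A = (m1 \x^ m2) A.
  apply: product_measure_unique => //= B C mB mC.
  exact: product_measure2E.
have mF : measurable_fun [set: T1 * T2] (fun z => (phi z.2 z.1, z.2)).
  exact: measurable_fun_pair.
split=> // A mA; apply: etrans (m12E _ _) (etrans _ (esym (m12E _ mA))).
  by rewrite -[X in measurable X]setTI; exact: mF.
apply: eq_integral => y _ /=; rewrite -[RHS](phiP y).2; last first.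
  exact: measurable_ysection.
by congr (m1 _); apply/seteqP; split=> x; rewrite /ysection/= !inE.
Qed.

End Fibres.
Arguments measure_preserving_fst {d1 d2 T1 T2 R}.
Arguments measure_preserving_snd {d1 d2 T1 T2 R}.

(** * Invariance of Lebesgue measure under shifts, shears and rotations *)

Section LebesgueInvariance.
Context (R : realType).
Implicit Types a b : R.

(** Lebesgue measure is determined by its values on half-open intervals, and the pushforward under
    the shift has the same ones. *)
Lemma leb1_preserving_shift a : measure_preserving (@leb1 R) (fun x => x + a).
Proof.
split=> [|A mA]; first exact: measurable_funD.
rewrite -[LHS]/(pushforward lebesgue_measure
  (fun x => x + a : measurableTypeR R) A).
apply/esym/lebesgue_measure_unique => //=; first exact: measurable_funD.
move=> mf _ [[u v] _ <-]; rewrite /pushforward.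
have -> : (fun x => x + a) @^-1` `]u, v] = `]u - a, v - a]%classic.
  by apply/seteqP; split=> x /=; rewrite !in_itv/= ltrBlDr lerBrDr.
rewrite /leb1 !lebesgue_measure_itv/= !lte_fin ltrD2r.
by case: ifP => // _; rewrite -!EFinB; congr (_%:E); ring.
Qed.

Lemma leb1_preserving_opp : measure_preserving (@leb1 R) -%R.
Proof.
by split=> [|A mA]; [exact: oppr_measurable|exact: lebesgue_measureN].
Qed.

Local Notation leb1 := (@leb1 R).
Let preserving2 := measure_preserving (@leb2 R).

Lemma leb2_preserving_shift a b : preserving2 (fun z => (z.1 + a, z.2 + b)).
Proof.
have shift1 : preserving2 (fun z => (z.1 + a, z.2)).
  apply: (measure_preserving_fst leb1 leb1 (fun _ x => x + a)).
    exact: measurable_funD.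
  by move=> _; exact: leb1_preserving_shift.
have shift2 : preserving2 (fun z => (z.1, z.2 + b)).
  apply: (measure_preserving_snd leb1 leb1 (fun _ x => x + b)).
    exact: measurable_funD.
  by move=> _; exact: leb1_preserving_shift.
exact: measure_preserving_comp shift1 shift2.
Qed.

Let shear_fst a : preserving2 (fun z => (z.1 + a * z.2, z.2)).
Proof.
apply: (measure_preserving_fst leb1 leb1 (fun y x => x + a * y)).
  by apply: measurable_funD => //; exact: measurable_funM.
by move=> y; exact: leb1_preserving_shift.
Qed.

Let shear_snd a : preserving2 (fun z => (z.1, z.2 + a * z.1)).
Proof.
apply: (measure_preserving_snd leb1 leb1 (fun x y => y + a * x)).
  by apply: measurable_funD => //; exact: measurable_funM.
by move=> y; exact: leb1_preserving_shift.
Qed.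

Let opp_fst : preserving2 (fun z => (- z.1, z.2)).
Proof.
apply: (measure_preserving_fst leb1 leb1 (fun _ x => - x)).
  exact: measurable_funN.
by move=> _; exact: leb1_preserving_opp.
Qed.

Let opp_snd : preserving2 (fun z => (z.1, - z.2)).
Proof.
apply: (measure_preserving_snd leb1 leb1 (fun _ x => - x)).
  exact: measurable_funN.
by move=> _; exact: leb1_preserving_opp.
Qed.

(* Away from the half turn, with [k = tan (theta / 2)], the rotation is the
   product of three shears. *)
Lemma leb2_preserving_rotation (theta : R) (p := direction theta) :
  preserving2 (fun z => (z.1 * p.1 - z.2 * p.2, z.1 * p.2 + z.2 * p.1)).
Proof.
rewrite /p /direction /=; have := cos2Dsin2 theta.
move: (cos theta) (sin theta) => c s cs1.
(* If [1 + c = 0], then [s = 0] and the map is the product of the two coordinate reflections. *)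
have [c1|c1] := eqVneq (1 + c) 0.
  have s0 : s = 0 by apply/eqP; rewrite -sqrf_eq0; apply/eqP; nra.
  have cN1 : c = -1 by lra.
  rewrite (_ : (fun _ => _) = (fun z : R * R => (- z.1, z.2)) \o
                              (fun z : R * R => (z.1, - z.2))).
    exact: (measure_preserving_comp opp_fst opp_snd).
  by apply/funext => z /=; rewrite s0 cN1; congr (_, _); ring.
pose k := s / (1 + c).
rewrite (_ : (fun _ => _) = (fun z : R * R => (z.1 + - k * z.2, z.2)) \o
  ((fun z : R * R => (z.1, z.2 + s * z.1)) \o
   (fun z : R * R => (z.1 + - k * z.2, z.2)))).
  exact: (measure_preserving_comp (shear_fst _)
    (measure_preserving_comp (shear_snd _) (shear_fst _))).
(* The half-angle identities [c = 1 - s * k] and [s = k * (2 - s * k)] suffice to match the product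
   of shears; once they are available, [k] can be treated as a free variable and only polynomial
   identities remain. *)
have cE : c = 1 - s * k.
  have : s * k = (1 - c) * (1 + c) / (1 + c).
    by rewrite mulrA; congr (_ / _); lra.
  by rewrite mulfK// => ->; ring.
have sE : s = k * (2 - s * k) by rewrite -[LHS](divfK c1) -/k cE; ring.
clearbody k; apply/funext => z /=; rewrite cE; congr (_, _); last by ring.
by rewrite [X in _ - z.2 * X]sE; ring.
Qed.

End LebesgueInvariance.

(** * Real and imaginary parts of complex numbers *)

Section ComplexParts.
Context (R : rcfType).
Implicit Types x y z : R[i].

Lemma complex_ReD x y : complex.Re (x + y) = complex.Re x + complex.Re y.
Proof. by case: x; case: y. Qed.

Lemma complex_ImD x y : complex.Im (x + y) = complex.Im x + complex.Im y.
Proof. by case: x; case: y. Qed.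

Lemma complex_ReM x y : complex.Re (x * y) =
  complex.Re x * complex.Re y - complex.Im x * complex.Im y.
Proof. by case: x; case: y. Qed.

Lemma complex_ImM x y : complex.Im (x * y) =
  complex.Re x * complex.Im y + complex.Im x * complex.Re y.
Proof. by case: x; case: y. Qed.

Lemma sqr_normc z :
  Normc.normc z ^+ 2 = complex.Re z ^+ 2 + complex.Im z ^+ 2.
Proof. by case: z => a b; rewrite sqr_sqrtr// addr_ge0// sqr_ge0. Qed.

Lemma normc_ge0 z : 0 <= Normc.normc z.
Proof. by case: z => a b; exact: sqrtr_ge0. Qed.

End ComplexParts.

Lemma lincombE (T : Type) (R : realType) (I : choiceType) (A : set I)
    (c : I -> R[i]) (e : I -> T -> R[i]) : finite_set A ->
  lincomb A c e = fun x => \sum_(k <- fset_set A) c k * e k x.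
Proof. by move=> finA; apply/funext => x; exact: fsbig_finite. Qed.

(** * Integration and square integrability of complex-valued functions *)

Section ComplexIntegral.
Context d (T : measurableType d) (R : realType).
Variable mu : {measure set T -> \bar R}.
Implicit Types (f g : T -> R[i]) (a : R[i]).

Lemma cmeasurable_comp f (h : T -> T) :
  cmeasurable f -> measurable_fun [set: T] h -> cmeasurable (f \o h).
Proof.
by move=> [mRe mIm] mh; split;
  [exact: measurableT_comp mRe mh|exact: measurableT_comp mIm mh].
Qed.

Lemma cmeasurable_cst a : cmeasurable (fun _ : T => a).
Proof. by split; exact: measurable_cst. Qed.

Lemma cmeasurableD f g : cmeasurable f -> cmeasurable g ->
  cmeasurable (fun x => f x + g x).
Proof.
move=> [fRe fIm] [gRe gIm]; split.
  by under eq_fun do rewrite complex_ReD; exact: measurable_funD.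
by under eq_fun do rewrite complex_ImD; exact: measurable_funD.
Qed.

Lemma cmeasurableZ a f : cmeasurable f -> cmeasurable (fun x => a * f x).
Proof.
move=> [fRe fIm]; split.
  under eq_fun do rewrite complex_ReM.
  by apply: measurable_funB; exact: measurable_funM.
under eq_fun do rewrite complex_ImM.
by apply: measurable_funD; exact: measurable_funM.
Qed.

Definition cintegrable f : Prop :=
  mu.-integrable [set: T] (fun x => (complex.Re (f x))%:E) /\
  mu.-integrable [set: T] (fun x => (complex.Im (f x))%:E).

Lemma cintegrable0 : cintegrable (fun=> 0).
Proof. by split; exact: integrable0. Qed.

Lemma cintegrableD f g : cintegrable f -> cintegrable g ->
  cintegrable (fun x => f x + g x).
Proof.
move=> [fRe fIm] [gRe gIm]; split.
  by under eq_fun do rewrite complex_ReD EFinD; exact: integrableD.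
by under eq_fun do rewrite complex_ImD EFinD; exact: integrableD.
Qed.

Lemma cintegrableZ a f : cintegrable f -> cintegrable (fun x => a * f x).
Proof.
move=> [fRe fIm]; split.
  under eq_fun do rewrite complex_ReM EFinB !EFinM.
  by apply: integrableB => //; exact: integrableZl.
under eq_fun do rewrite complex_ImM EFinD !EFinM.
by apply: integrableD => //; exact: integrableZl.
Qed.

Lemma cintegrable_measure_preserving f (h : T -> T) :
  measure_preserving mu h -> cintegrable f -> cintegrable (f \o h).
Proof.
move=> hP [fRe fIm]; split.
  exact: (integrable_measure_preserving hP fRe).
exact: (integrable_measure_preserving hP fIm).
Qed.

Lemma cintegral_measure_preserving f (h : T -> T) :
  measure_preserving mu h -> cmeasurable f ->
  cintegral mu (f \o h) = cintegral mu f.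
Proof.
move=> hP [fRe fIm]; congr Complex; congr fine.
  apply: (integral_measure_preserving
    (f := fun x => (complex.Re (f x))%:E) hP).
  exact/measurable_EFinP.
apply: (integral_measure_preserving
    (f := fun x => (complex.Im (f x))%:E) hP).
exact/measurable_EFinP.
Qed.

Lemma ae_eq_cintegral f g : cmeasurable f -> cmeasurable g ->
  f = g %[ae mu] -> cintegral mu f = cintegral mu g.
Proof.
move=> [fRe fIm] [gRe gIm] fg; congr Complex; congr fine;
  apply: ae_eq_integral => //; try exact/measurable_EFinP.
  by apply: filterS fg => x /[apply] ->.
by apply: filterS fg => x /[apply] ->.
Qed.

Lemma cintegral0 : cintegral mu (fun=> 0) = 0.
Proof. by rewrite /cintegral /Rintegral !integral0. Qed.

Lemma cintegralD f g : cintegrable f -> cintegrable g ->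
  cintegral mu (fun x => f x + g x) = cintegral mu f + cintegral mu g.
Proof.
move=> [fRe fIm] [gRe gIm]; rewrite /cintegral.
under eq_Rintegral do rewrite complex_ReD.
under [X in Complex _ X]eq_Rintegral do rewrite complex_ImD.
by rewrite !RintegralD.
Qed.

Lemma cintegralZ a f : cintegrable f ->
  cintegral mu (fun x => a * f x) = a * cintegral mu f.
Proof.
move=> [fRe fIm]; rewrite /cintegral.
under eq_Rintegral do rewrite complex_ReM.
under [X in Complex _ X]eq_Rintegral do rewrite complex_ImM.
have intZ (r : R) (h : T -> R) : mu.-integrable setT (EFin \o h) ->
    mu.-integrable setT (EFin \o (fun x => r * h x)).
  by move=> ih; rewrite (_ : _ \o _ = fun x => (r%:E * (h x)%:E)%E)//;
     exact: integrableZl.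
rewrite RintegralB//; try exact: intZ.
rewrite RintegralD//; try exact: intZ.
by rewrite !RintegralZl//; case: a.
Qed.

(** The square of the norm is the integral of [|f|^2], and squaring preserves and reflects
    finiteness. This removes the root from the closure proofs below. *)
Lemma cL2P f : cL2 mu f <-> cmeasurable f /\
  (\int[mu]_x (complex.Re (f x) ^+ 2 + complex.Im (f x) ^+ 2)%:E < +oo)%E.
Proof.
pose N := cL2norm mu f.
have NE : (N `^ 2 = \int[mu]_x
    (complex.Re (f x) ^+ 2 + complex.Im (f x) ^+ 2)%:E)%E.
  rewrite /N /cL2norm poweR_Lnorm//; apply: eq_integral => x _ /=.
  by rewrite ger0_norm ?normc_ge0// powR_mulrn ?normc_ge0// sqr_normc.
have N0 : (0 <= N)%E by exact: Lnorm_ge0.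
rewrite /cL2 -NE -/N; split=> -[mf Noo]; split => //.
  by rewrite poweR_lty.
move: Noo N0; case: N {NE} => [r _ _|+ _|//]; first exact: ltry.
by rewrite poweRyr.
Qed.

Lemma cL20 : cL2 mu (fun=> 0).
Proof.
apply/cL2P; split; first exact: cmeasurable_cst.
by rewrite integral0_eq ?ltry// => x _ /=; rewrite expr0n/= addr0.
Qed.

Lemma cL2Z a f : cL2 mu f -> cL2 mu (fun x => a * f x).
Proof.
move=> /cL2P[mf foo]; apply/cL2P; split; first exact: cmeasurableZ.
(* [r] is [|a|^2], and the modulus is multiplicative. *)
pose r := complex.Re a ^+ 2 + complex.Im a ^+ 2.
under eq_integral => x _.
  rewrite (_ : _ + _ =
    r * (complex.Re (f x) ^+ 2 + complex.Im (f x) ^+ 2)); last first.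
    by rewrite complex_ReM complex_ImM /r; ring.
  rewrite EFinM.
  over.
rewrite ge0_integralZl//.
- by rewrite lte_mul_pinfty// lee_fin addr_ge0// sqr_ge0.
- apply/measurable_EFinP; case: mf => mRe mIm.
  by apply: measurable_funD; exact: measurable_funX.
- by move=> x _; rewrite lee_fin addr_ge0// sqr_ge0.
- by rewrite lee_fin addr_ge0// sqr_ge0.
Qed.

Lemma cL2D f g : cL2 mu f -> cL2 mu g -> cL2 mu (fun x => f x + g x).
Proof.
move=> /cL2P[mf foo] /cL2P[mg goo]; apply/cL2P.
split; first exact: cmeasurableD.
pose n (h : T -> R[i]) x := complex.Re (h x) ^+ 2 + complex.Im (h x) ^+ 2.
have n0 h x : 0 <= n h x by rewrite addr_ge0// sqr_ge0.
have mn h : cmeasurable h -> measurable_fun [set: T] (fun x => (n h x)%:E).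
  move=> [mRe mIm]; apply/measurable_EFinP.
  by apply: measurable_funD; exact: measurable_funX.
(* The bound [|f + g|^2 <= 2 |f|^2 + 2 |g|^2], whose defect is [|f - g|^2]. *)
apply: (@le_lt_trans _ _
    (\int[mu]_x (2%:E * (n f x)%:E + 2%:E * (n g x)%:E))%E).
  apply: ge0_le_integral => //.
  - by move=> x _; rewrite lee_fin; exact: (n0 (fun x => f x + g x)).
  - by apply: (mn (fun x => f x + g x)); exact: cmeasurableD.
  - by apply: emeasurable_funD; apply: measurable_funeM; exact: mn.
  - move=> x _; rewrite -!EFinM -EFinD lee_fin complex_ReD complex_ImD /n.
    have := sqr_ge0 (complex.Re (f x) - complex.Re (g x)).
    have := sqr_ge0 (complex.Im (f x) - complex.Im (g x)).
    by lra.
rewrite ge0_integralD//=.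
- rewrite !ge0_integralZl ?lte_add_pinfty ?lte_mul_pinfty//; try exact: mn.
  + by move=> x _; rewrite lee_fin n0.
  + by move=> x _; rewrite lee_fin n0.
- by move=> x _; rewrite mule_ge0// lee_fin n0.
- by apply: measurable_funeM; exact: mn.
- by move=> x _; rewrite mule_ge0// lee_fin n0.
- by apply: measurable_funeM; exact: mn.
Qed.

Lemma cL2_measure_preserving f (h : T -> T) :
  measure_preserving mu h -> cL2 mu f -> cL2 mu (f \o h).
Proof.
move=> hP /cL2P[mf foo]; apply/cL2P; split.
  by apply: cmeasurable_comp => //; case: hP.
pose n x := complex.Re (f x) ^+ 2 + complex.Im (f x) ^+ 2 : R.
rewrite (integral_measure_preserving (f := EFin \o n) hP)//.
case: mf => mRe mIm; apply/measurable_EFinP.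
by apply: measurable_funD; exact: measurable_funX.
Qed.

Lemma cL2_lincomb (I : choiceType) (A : set I) (c : I -> R[i])
    (e : I -> T -> R[i]) :
  finite_set A -> (forall k, cL2 mu (e k)) -> cL2 mu (lincomb A c e).
Proof.
move=> finA eL2; rewrite lincombE//.
elim: (enum_fset _) => [|k s IHs].
  by under eq_fun do rewrite big_nil; exact: cL20.
by under eq_fun do rewrite big_cons; exact/cL2D/IHs/cL2Z.
Qed.

End ComplexIntegral.

#[local] Instance ae_leb1_filter (R : realType) :
  Filter (nbhs (almost_everywhere (@leb1 R))).
Proof. exact: (ae_filter_ringOfSetsType lebesgue_measure). Qed.

#[local] Instance ae_leb2_filter (R : realType) :
  Filter (nbhs (almost_everywhere (@leb2 R))).
Proof.
exact: (ae_filter_ringOfSetsType (lebesgue_measure \x lebesgue_measure)%E).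
Qed.

(** * Essential support and integrability *)

Section Support.
Context (R : realType).
Implicit Types (f : R * R -> R[i]) (z : R * R).

(* Lindelof: the boxes with rational corners form a countable base. *)
Lemma ess_support_ae0 f :
  \forall z \ae (@leb2 R), ~ ess_support f z -> f z = 0.
Proof.
pose box (q : (rat * rat) * (rat * rat)) : set (R * R) :=
  `]ratr q.1.1, ratr q.1.2[ `*` `]ratr q.2.1, ratr q.2.2[.
pose null q := f = cst 0 %[ae (@leb2 R) in box q].
(* If [n] codes a box on which [f] vanishes almost everywhere, [F n] is the set of exceptional
   points in that box; otherwise it is empty. The union of all [F n] is then negligible. *)
pose F (n : nat) : set (R * R) := if choice.unpickle n is Some q then
  if pselect (null q) is left _ then [set z | ~ (box q z -> f z = 0)] else set0
  else set0.
have Fnull n : (@leb2 R).-negligible (F n).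
  rewrite /F; case: choice.unpickle => [q|]; last exact: negligible_set0.
  by case: pselect => // _; exact: negligible_set0.
apply: negligibleS (negligible_bigcup Fnull) => z /= /not_implyP[+ fz].
move=> /contrapT[U [oU fU] Uz].
have /nbhs_ballP[e /= e0 zeU] : nbhs z U by exact: open_nbhs_nbhs.
(* Rational corners within [e] of [z] on either side of each coordinate give a box that contains [z]
   and lies in the ball, hence in [U]. *)
have /rat_in_itvoo[q1 q1z] : z.1 - e < z.1 by lra.
have /rat_in_itvoo[q2 q2z] : z.1 < z.1 + e by lra.
have /rat_in_itvoo[q3 q3z] : z.2 - e < z.2 by lra.
have /rat_in_itvoo[q4 q4z] : z.2 < z.2 + e by lra.
pose q := ((q1, q2), (q3, q4)).
have zq : box q z.
  move: q1z q2z q3z q4z; rewrite /box/= !in_itv/=.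
  by move=> /andP[_ ->] /andP[-> _] /andP[_ ->] /andP[-> _].
have qU : box q `<=` U.
  move=> w [/=]; rewrite !in_itv/= => /andP[w1 w2] /andP[w3 w4]; apply: zeU.
  move: q1z q2z q3z q4z; rewrite !in_itv/=.
  move=> /andP[q1z _] /andP[_ q2z] /andP[q3z _] /andP[_ q4z].
  split; rewrite /ball/= ltr_distlC; apply/andP; split; lra.
have nullq : null q by apply: filterS fU => w fw /qU.
exists (choice.pickle q); first exact: I.
by rewrite /F choice.pickleK; case: pselect => // _ /= /(_ zq).
Qed.

(** With [D] the rectangle, of finite measure, the real and imaginary parts are dominated almost
    everywhere by [1_D + |f|^2]: on [D] because [|h| <= 1 + h^2], outside [D] because [f] vanishes
    there almost everywhere. *)
Lemma cL2_bounded_support_integrable f (N1 M1 N2 M2 : R) :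
  cL2 (@leb2 R) f -> ess_support f `<=` rect N1 M1 N2 M2 ->
  cintegrable (@leb2 R) f.
Proof.
move=> /cL2P[mf foo] fS.
pose D := rect N1 M1 N2 M2.
pose n z := complex.Re (f z) ^+ 2 + complex.Im (f z) ^+ 2.
have mD : measurable D by exact: measurableX.
have Doo : (leb2 D < +oo)%E.
  rewrite /leb2 /D /rect product_measure1E//= !lebesgue_measure_itv/=.
  by case: ifP => _; case: ifP => _; rewrite -?EFinB ?mule0 ?mul0e -?EFinM ltry.
have n0 z : 0 <= n z by rewrite addr_ge0// sqr_ge0.
have mn : measurable_fun [set: R * R] (EFin \o n).
  case: mf => mRe mIm; apply/measurable_EFinP.
  by apply: measurable_funD; exact: measurable_funX.
have mI : measurable_fun [set: R * R] (fun z => (\1_D z)%:E : \bar R).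
  by apply/measurable_EFinP; exact: measurable_indic.
have dominated (h : R * R -> R) : measurable_fun [set: R * R] h ->
    (forall z, h z ^+ 2 <= n z) ->
    (@leb2 R).-integrable [set: R * R] (EFin \o h).
  move=> mh hn; apply/integrableP; split; first exact/measurable_EFinP.
  apply: (@le_lt_trans _ _ (\int[@leb2 R]_z ((\1_D z)%:E + (n z)%:E))%E).
    apply: ae_ge0_le_integral => //.
    - by apply: measurableT_comp => //; exact/measurable_EFinP.
    - by move=> z _; rewrite adde_ge0 ?lee_fin.
    - exact: emeasurable_funD.
    - apply: filterS (ess_support_ae0 f) => z fz _.
      rewrite -EFinD lee_fin indicE.
      have [zD|/negP zD] := boolP (z \in D).
        have := hn z; have := sqr_ge0 (h z); have := sqr_ge0 (`|h z| - 1).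
        by rewrite /= mulr1n sqrrB real_normK ?num_real//=; lra.
      have nz : n z = 0.
        by rewrite /n fz ?expr0n ?addr0//= => /fS Dz; apply: zD; rewrite inE.
      have := hn z; rewrite nz => hz0.
      have -> : h z = 0 by apply/eqP; rewrite -sqrf_eq0 eq_le hz0 sqr_ge0.
      by rewrite normr0 addr0.
  rewrite ge0_integralD//; last by move=> z _; rewrite lee_fin.
  apply: lte_add_pinfty; last exact: foo.
  by rewrite integral_indic// setIT; exact: Doo.
case: (mf) => mRe mIm; split; apply: dominated => // z.
  by rewrite lerDl sqr_ge0.
by rewrite lerDr sqr_ge0.
Qed.

End Support.

(** * The Radon transform at a single angle *)

Section Radon.
Context (R : realType) (theta : R).
Let p := direction theta.
Implicit Types (f g : R * R -> R[i]).

Let rotation (z : R * R) : R * R :=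
  (z.1 * p.1 - z.2 * p.2, z.1 * p.2 + z.2 * p.1).

(** The integrand of [radon p f t], seen as a vertical fibre of [f] composed with the rotation; this
    makes Fubini applicable. *)
Let slice f t s := f (rotation (t, s)).

Let rotation_preserving : measure_preserving (@leb2 R) rotation.
Proof. exact: leb2_preserving_rotation. Qed.

Let cmeasurable_slice f t : cmeasurable f -> cmeasurable (slice f t).
Proof.
move=> [mRe mIm].
have mslice : measurable_fun [set: R] (fun s => rotation (t, s)).
  by apply: measurable_fun_pair => /=;
    [apply: measurable_funB|apply: measurable_funD]; apply: measurable_funM.
by split;
  [exact: measurableT_comp mRe mslice|exact: measurableT_comp mIm mslice].
Qed.

(** Fubini for [f] composed with the rotation, which is again integrable on the plane. *)
Let ae_cintegrable_slice f : cintegrable (@leb2 R) f ->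
  \forall t \ae (@leb1 R), cintegrable (@leb1 R) (slice f t).
Proof.
move=> /(cintegrable_measure_preserving rotation_preserving)[fRe fIm].
by apply: filterS2 (ae_integrable1 fRe) (ae_integrable1 fIm) => t.
Qed.

(** The rotation pulls the exceptional null set back to a null set, and almost every fibre of the
    latter is null. *)
Lemma radon_ae_eq f g : cmeasurable f -> cmeasurable g ->
  f = g %[ae (@leb2 R)] -> radon p f = radon p g %[ae (@leb1 R)].
Proof.
move=> mf mg /(ae_measure_preserving rotation_preserving)/ae_prod_fst.
apply: filterS => t fgt _.
by apply: ae_eq_cintegral; [exact: (cmeasurable_slice t mf)|
                            exact: (cmeasurable_slice t mg)|].
Qed.

Lemma radonD f g : cintegrable (@leb2 R) f -> cintegrable (@leb2 R) g ->
  radon p (fun z => f z + g z) = (fun t => radon p f t + radon p g t)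
  %[ae (@leb1 R)].
Proof.
move=> /ae_cintegrable_slice + /ae_cintegrable_slice.
by apply: filterS2 => t ft gt _; exact: cintegralD.
Qed.

Lemma radonZ a f : cintegrable (@leb2 R) f ->
  radon p (fun z => a * f z) = (fun t => a * radon p f t) %[ae (@leb1 R)].
Proof.
by move=> /ae_cintegrable_slice; apply: filterS => t ft _; exact: cintegralZ.
Qed.

Lemma radon_lincomb (J : choiceType) (A : set J) (c : J -> R[i])
    (e : J -> R * R -> R[i]) :
  finite_set A -> (forall k, cintegrable (@leb2 R) (e k)) ->
  radon p (lincomb A c e) = lincomb A c (fun k => radon p (e k))
  %[ae (@leb1 R)].
Proof.
move=> finA eint; rewrite !lincombE//.
(* Integrability of the partial sums is carried through the induction because [radonD] requires
   it. *)
suff : cintegrable (@leb2 R)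
      (fun z => \sum_(k <- fset_set A) c k * e k z) /\
    radon p (fun z => \sum_(k <- fset_set A) c k * e k z) =
    (fun t => \sum_(k <- fset_set A) c k * radon p (e k) t)
    %[ae (@leb1 R)] by case.
elim: (enum_fset _) => [|k s [sint IHs]].
  split; first by under eq_fun do rewrite big_nil; exact: cintegrable0.
  apply: nearW => t _; under eq_fun do rewrite big_nil.
  by rewrite big_nil; exact: cintegral0.
have kint : cintegrable (@leb2 R) (fun z => c k * e k z) by exact: cintegrableZ.
split; first by under eq_fun do rewrite big_cons; exact: cintegrableD.
apply: filterS3 (radonD kint sint) (radonZ (c k) (eint k)) IHs.
move=> t /(_ I) DE /(_ I) ZE /(_ I) sE _; under eq_fun do rewrite big_cons.
by rewrite DE ZE sE big_cons.
Qed.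

(* In the orthonormal frame [p], [p^\perp], the translation by [k] is a shift of
   [t] by [p k] followed by a shift of the integration variable. *)
Lemma radon_translate f (k : int * int) t : cmeasurable f ->
  radon p (translate f k) t = radon p f (t - pair_dir p k).
Proof.
(* [- v] is the component of [k] along [(- p.2, p.1)], so subtracting [k] replaces [s] by
   [s + v]. *)
move=> mf; pose v : R := k.1%:~R * p.2 - k.2%:~R * p.1.
rewrite -[RHS](cintegral_measure_preserving (leb1_preserving_shift v)
  (cmeasurable_slice (t - pair_dir p k) mf)).
congr (cintegral _ _); apply/funext => s.
rewrite /translate /slice /rotation /pair_dir /v /=; congr (f (_, _)).
  transitivity (t * cos theta - s * sin theta -
    k.1%:~R * (cos theta ^+ 2 + sin theta ^+ 2)); last by ring.
  by rewrite cos2Dsin2 mulr1.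
transitivity (t * sin theta + s * cos theta -
    k.2%:~R * (cos theta ^+ 2 + sin theta ^+ 2)); last by ring.
by rewrite cos2Dsin2 mulr1.
Qed.

End Radon.

(** * Integrability of the integer translates *)

Section Translates.
Context (R : realType).
Implicit Types (phi : R * R -> R[i]) (k : int * int).

Let shift k (z : R * R) : R * R := (z.1 - k.1%:~R, z.2 - k.2%:~R).

Let shift_preserving k : measure_preserving (@leb2 R) (shift k).
Proof. exact: leb2_preserving_shift. Qed.

Lemma cintegrable_translate phi k : cintegrable (@leb2 R) phi ->
  cintegrable (@leb2 R) (translate phi k).
Proof. exact: (cintegrable_measure_preserving (shift_preserving k)). Qed.

Lemma cL2_translate phi k : cL2 (@leb2 R) phi ->
  cL2 (@leb2 R) (translate phi k).
Proof. exact: (cL2_measure_preserving (shift_preserving k)). Qed.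

End Translates.

(** * Finiteness of the index set, and the equivalence *)

Lemma finite_index_set (R : realType) (N1 M1 N2 M2 a1 b1 a2 b2 : R) :
  finite_set (index_set N1 M1 N2 M2 a1 b1 a2 b2).
Proof.
have finZ (m n : int) : finite_set [set i : int | m <= i <= n].
  have [mn|nm] := leP m n; last first.
    apply: sub_finite_set (finite_set0 _) => i /= /andP[mi ni].
    by move: (lt_le_trans nm (le_trans mi ni)); rewrite ltxx.
  (* The offsets [i - m] run from [0] to [n - m] inclusive, hence the successor in the strict
     bound. *)
  apply: sub_finite_set (finite_image (fun j : nat => m + j%:Z)
    (finite_II (absz (n - m)).+1)) => i /= /andP[mi ni].
  by exists (absz (i - m)); lia.
apply: sub_finite_set (finite_setX (finZ _ _) (finZ _ _)) => k [k1 k2].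
by split; [exact: k1|exact: k2].
Qed.

Theorem theorem3p1 (R : realType) (phi : R * R -> R[i])
  (N1 M1 N2 M2 theta a1 b1 a2 b2 : R)
  (phiL2 : cL2 (@leb2 R) phi)
  (phi_supp : ess_support phi `<=` rect N1 M1 N2 M2)
  (phi_indep : lin_indep (@leb2 R) [set: int * int] (translate phi))
  (ab1 : a1 <= b1) (ab2 : a2 <= b2) :
  let p := direction theta in
  let E := index_set N1 M1 N2 M2 a1 b1 a2 b2 in
  (forall f : R * R -> R[i],
     in_V phi f -> ess_support f `<=` rect a1 b1 a2 b2 -> in_span phi E f ->
     determined_by_radon p phi E f)
  <->
  lin_indep (@leb1 R) E
    (fun (k : int * int) (t : R) => radon p phi (t - pair_dir p k)).
Proof.
move=> p E.
have finE : finite_set E by exact: finite_index_set.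
have phiint := cL2_bounded_support_integrable phiL2 phi_supp.
have transL2 k := cL2_translate k phiL2.
(* Stated for any finite [A]: necessity uses it for a finite subset of [E], sufficiency for [E]
   itself. *)
have radon_comb (A : set (int * int)) c : finite_set A ->
    radon p (lincomb A c (translate phi)) =
    lincomb A c (fun k t => radon p phi (t - pair_dir p k)) %[ae (@leb1 R)].
  move=> finA.
  have := radon_lincomb theta c finA (fun k => cintegrable_translate k phiint).
  apply: filterS => t /[apply] ->; rewrite !lincombE//; apply: eq_bigr => k _.
  by rewrite radon_translate//; case: phiL2.
have comb0 (T : Type) (A : set (int * int)) (e : int * int -> T -> R[i]) :
    lincomb A (fun=> 0) e = cst 0.
  by apply/funext => x; apply: fsbig1 => k _; rewrite mul0r.
split=> [det A c finA AE cA0 k Ak|indep f _ _ [fL2 [c fE]] g [gL2 [d gE]] gf].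
  (* Necessity: [g] carries the coefficients of a vanishing combination back to the plane. Its Radon
     transform is that of [0], so [g = 0] by determination, and independence of the translates gives
     [c k = 0]. *)
  pose g := lincomb A c (translate phi).
  have gL2 : cL2 (@leb2 R) g by exact: cL2_lincomb.
  have gspan : in_span phi E g.
    (* The coefficients are extended by zero from [A] to [E]. *)
    split=> //; exists (fun k => if k \in A then c k else 0); apply: aeW => z _.
    rewrite /g /lincomb -[in LHS](setIidr AE) fsbig_mkcondr.
    by apply: eq_fsbigr => j _; case: ifP => // _; rewrite mul0r.
  apply: phi_indep (finA) _ _ k Ak => //.
  apply: (det (cst 0)) => //.
  (* The zero function is an admissible target: with zero coefficients all partial sums are exact,
     so [fset0] serves for every [eps], and its essential support is empty because it vanishes on
     the whole plane. *)
  - split; first exact: cL20.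
    exists (fun=> 0); split.
      by rewrite esum1 ?ltry// => k' _; rewrite Normc.normc0 expr0n.
    move=> eps eps0; exists fset0 => F _.
    rewrite comb0 /cL2norm.
    under eq_Lnorm do rewrite subr0 Normc.normc0.
    by rewrite Lnorm0 ?lte_fin.
  - move=> z; case; exists setT => //; split; first exact: openT.
    exact: aeW.
  - split; first exact: cL20.
    by exists (fun=> 0); rewrite comb0; apply: aeW.
  apply: filterS2 (radon_comb A c finA) cA0 => t /(_ I)gt /(_ I)t0 _.
  by rewrite gt t0 /radon cintegral0.
have mcomb a : cmeasurable (lincomb E a (translate phi)).
  by case: (cL2_lincomb a finE transL2).
have radon_rep (h : R * R -> R[i]) a : cL2 (@leb2 R) h ->
    h = lincomb E a (translate phi) %[ae (@leb2 R)] ->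
    radon p h =
    lincomb E a (fun k t => radon p phi (t - pair_dir p k)) %[ae (@leb1 R)].
  move=> [mh _] hE; have := radon_ae_eq theta mh (mcomb a) hE.
  by apply: filterS2 (radon_comb E a finE) => t Et ht _; rewrite ht// Et.
(* Sufficiency: equal Radon transforms make the combination with coefficients [d - c] vanish, so
   independence forces agreement on [E]. *)
have dc k : E k -> d k = c k.
  move=> Ek; apply/eqP; rewrite -subr_eq0; apply/eqP.
  apply: (indep E (fun k => d k - c k)) => //.
  apply: filterS3 gf (radon_rep _ _ fL2 fE) (radon_rep _ _ gL2 gE).
  move=> t /(_ I)gft /(_ I)ft /(_ I)gt _.
  move: gft; rewrite ft gt !lincombE// => /eqP; rewrite -subr_eq0 -sumrB.
  move=> /eqP dc0; rewrite -[RHS]dc0.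
  by apply: eq_bigr => j _; rewrite mulrBl.
apply: filterS2 fE gE => z /(_ I)-> /(_ I)-> _.
(* [d] and [c] are known to agree only on [E], so membership of the summation index has to be
   kept. *)
rewrite !lincombE// big_seq [RHS]big_seq; apply: eq_bigr => j.
by rewrite in_fset_set// inE => /dc->.
Qed.
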